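(* Let $p$ be a prime and let $i\geq 0$. If $p$ is odd, then $O(c_i)=M_0\cdots M_i$. If $p=2$, then $O(c_0)=N_0$, $O(c_1)=N_0N_1$, $O(c_2)=N_1N_2$, $O(c_3)=N_1N_2N_3$, $O(c_4)=N_1N_2N_3N_4$, and for $i\geq 5$, $O(c_i)=N_1N_2N_3N_4M_5\cdots M_i$.
   Context: Fix a prime $p$ and an algebraic closure $E$ of $\mathbb{F}_p$. Put $c_{-1}=1$ and, recursively for $i\geq -1$, let $c_{i+1}\in E$ be any chosen root of $X^p-X-(c_{-1}c_0\cdots c_i)^{p-1}$. Put $L_{-1}=\mathbb{F}_p$ and $L_{i+1}=L_i[c_{i+1}]$ for $i\geq -1$. All $c_i$ are nonzero. For $i\geq 0$ put $N_i=\dfrac{p^{p^{i+1}}-1}{p^{p^i}-1}$, and let $M_i$ be the order of $c_i$ modulo $L_{i-1}^\times$, i.e. the smallest $n\geq 1$ with $c_i^n\in L_{i-1}^\times$. For $x\in E^\times$, $O(x)$ denotes the multiplicative order of $x$. *)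

(* Defs.v *)
From HB Require Import structures.
From mathcomp Require Import all_boot all_order all_algebra all_classical.

Set Implicit Arguments.
Unset Strict Implicit.
Unset Printing Implicit Defensive.

Import GRing.Theory.
Local Open Scope ring_scope.
Local Open Scope classical_set_scope.

(* E is an algebraic closure of F via iota: E is algebraically closed by its
   type, and it remains to ask that it be algebraic over F. *)
Definition algebraic_closure (F : fieldType) (E : closedFieldType)
    (iota : {rmorphism F -> E}) : Prop :=
  forall x : E, algebraicOver iota x.

Definition adjoin (E : fieldType) (K : set E) (x : E) : set E :=
  [set q.[x] | q in [set q : {poly E} | forall k, K q`_k]].

(* The sequence c starts at c_0; the term c_{-1} = 1 is absorbed in the empty
   product, so that c_0 is a root of X^p - X - 1. *)
Definition as_tower_seq (p : nat) (E : fieldType) (c : nat -> E) : Prop :=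
  forall i : nat,
    root ('X^p - 'X - ((\prod_(j < i) c j) ^+ p.-1)%:P) (c i).

(* Indices are shifted by one: pred_field iota c i is L_{i-1}. *)
Fixpoint pred_field (F E : fieldType) (iota : {rmorphism F -> E})
    (c : nat -> E) (i : nat) : set E :=
  if i is j.+1 then adjoin (pred_field iota c j) (c j) else range iota.

Definition is_order_mod (E : fieldType) (K : set E) (x : E) (n : nat) : Prop :=
  let P m := [/\ (0 < m)%N, K (x ^+ m) & x ^+ m != 0] in
  P n /\ forall m, P m -> (n <= m)%N.

(* The default value 0 is taken only if no positive power of x lies in the
   unit group of K. *)
Definition order_mod (E : fieldType) (K : set E) (x : E) : nat :=
  xget 0%N [set n | is_order_mod K x n].

Definition Mord (F E : fieldType) (iota : {rmorphism F -> E})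
    (c : nat -> E) (i : nat) : nat :=
  order_mod (pred_field iota c i) (c i).

(* The division is exact. *)
Definition Nquot (p i : nat) : nat :=
  ((p ^ (p ^ i.+1)).-1 %/ (p ^ (p ^ i)).-1)%N.

(* Main.v *)
Require Import Defs.
From HB Require Import structures.
From mathcomp Require Import all_boot all_order all_algebra all_classical.
From mathcomp Require Import all_field zify.

Set Implicit Arguments.
Unset Strict Implicit.
Unset Printing Implicit Defensive.

Import GRing.Theory.
Local Open Scope ring_scope.

(** Put q_i = p^(p^i) and P_i = c_0 ... c_(i-1), so that c_i^p - c_i = P_i^(p-1). By induction P_i
    is fixed by the q_i-Frobenius and P_i^(p-1) has absolute trace (-1)^i ([tower_trace_fixed]).
    Hence c_i^(q_i) = c_i + (-1)^i, the field L_(i-1) is the fixed field of x -> x^(q_i)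
    ([pred_fieldP]), the norm c_i^(N_i) equals P_i^(p-1) ([tower_norm]), and M_i is the order of
    c_i^(q_i - 1) ([Mord_primitive]).

    Since N_i = p modulo q_i - 1, the numbers N_i and q_i - 1 are coprime, and an order splits into
    the orders of its N_i-th and (q_i - 1)-th powers. This gives O(c_i) = O(P_i^(p-1)) M_i
    ([tower_order]) and O(P_(i+1)) = O(P_i^(2p-1)) M_i ([tower_prod_order_step]).

    The exponent p - 1 is coprime to every N_j, and so is 2p - 1 unless p = 2 and j = 0. For odd p
    all the factors M_j accumulate. For p = 2 the exponent 2p - 1 = 3 = N_0 kills the contribution
    of c_0 from P_2 on, while N_0, ..., N_4 are Fermat primes, which forces M_j = N_j there. *)

(** * Iterated Frobenius and trace sums *)

Lemma frob_rmorphism (p : nat) (R : comNzRingType) (pR : p \in [pchar R])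
    (n : nat) : exists f : {rmorphism R -> R}, forall x, f x = x ^+ (p ^ n).
Proof.
elim: n => [|n [f fE]]; first by exists idfun => x; rewrite expr1.
exists (pFrobenius_aut pR \o f) => x /=.
by rewrite fE pFrobenius_autE -exprM expnSr.
Qed.

Lemma sum_succ_mod (V : zmodType) (n : nat) (u : nat -> V) :
  u n = u 0%N -> \sum_(t < n) u t.+1 = \sum_(t < n) u t.
Proof.
move=> un; apply/eqP; rewrite -subr_eq0 -sumrB.
rewrite -(big_mkord xpredT (fun t => u t.+1 - u t)) telescope_sumr //.
by rewrite un subrr.
Qed.

(** Transitivity of the trace through the intermediate field of p^m elements, as a formal identity
    valid for every [x]. *)
Lemma sum_iter_frob (p : nat) (R : comNzRingType) (pR : p \in [pchar R])
    (m n : nat) (x : R) :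
  \sum_(j < m * n) x ^+ (p ^ j)
    = \sum_(j < m) (\sum_(s < n) x ^+ ((p ^ m) ^ s)) ^+ (p ^ j).
Proof.
elim: n => [|n IH].
  rewrite muln0 big_ord0 big1 // => j _; rewrite big_ord0 expr0n.
  by rewrite expn_eq0 eqn0Ngt (prime_gt0 (pcharf_prime pR)).
rewrite mulnS addnC big_split_ord /= IH -big_split /=.
apply: eq_bigr => j _; rewrite big_ord_recr /=.
have [f fE] := frob_rmorphism pR j.
by rewrite -!fE rmorphD !fE -exprM -expnM expnD.
Qed.

Lemma iter_frob_AS (p : nat) (R : comNzRingType) (pR : p \in [pchar R])
    (n : nat) (x a : R) :
  x ^+ p = x + a -> x ^+ (p ^ n) = x + \sum_(j < n) a ^+ (p ^ j).
Proof.
move=> xp; elim: n => [|n IH]; first by rewrite big_ord0 addr0 expr1.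
have [f fE] := frob_rmorphism pR n.
rewrite expnS exprM xp -fE rmorphD !fE IH big_ord_recr /= -addrA.
by congr (_ + _).
Qed.

Lemma expr_translate (p : nat) (R : comNzRingType) (pR : p \in [pchar R])
    (n t : nat) (x e : R) :
  e ^+ (p ^ n) = e -> x ^+ (p ^ n) = x + e ->
  x ^+ ((p ^ n) ^ t) = x + e *+ t.
Proof.
move=> eq xq; elim: t => [|t IH]; first by rewrite expr1 mulr0n addr0.
have [f fE] := frob_rmorphism pR n.
by rewrite expnSr exprM IH -fE rmorphD rmorphMn /= !fE eq xq mulrS addrA.
Qed.

(** * Sums and products over the translates by an F_p-line *)

Section PrimeSubfield.

Context (p : nat) (E : fieldType) (pE : p \in [pchar E]) (e : E).
Hypotheses (ep : e ^+ p = e) (e0 : e != 0).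

Let p_gt0 : (0 < p)%N := prime_gt0 (pcharf_prime pE).
Let p_gt1 : (1 < p)%N := prime_gt1 (pcharf_prime pE).

Lemma multiple_eq0 t : (e *+ t == 0) = (p %| t)%N.
Proof. by rewrite -mulr_natr mulf_eq0 (negPf e0) (dvdn_pcharf pE). Qed.

Lemma multiple_exprp t : (e *+ t) ^+ p = e *+ t.
Proof. by rewrite -(pFrobenius_autE pE) rmorphMn /= pFrobenius_autE ep. Qed.

Lemma multiple_expr_pred t : (0 < t < p)%N -> (e *+ t) ^+ p.-1 = 1.
Proof.
case/andP=> t0 tp; have nz : e *+ t != 0 by rewrite multiple_eq0 gtnNdvd.
by apply: (mulfI nz); rewrite mulr1 -exprS prednK // multiple_exprp.
Qed.

Let rs := [seq e *+ t | t <- iota 0 p].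

Let uniq_rs : uniq rs.
Proof.
rewrite map_inj_in_uniq ?iota_uniq // => s t.
rewrite !mem_iota !add0n /=.
wlog st : s t / (s <= t)%N => [H|] sp tp E1.
  by case/orP: (leq_total s t) => st; [exact: H|symmetry; exact: H].
have /eqP : e *+ (t - s) = 0 by rewrite mulrnBr // E1 subrr.
rewrite multiple_eq0; case: (posnP (t - s)) => [ts0 _|ts0].
  by apply/eqP; rewrite eqn_leq st -subn_eq0 ts0.
by rewrite gtnNdvd // (leq_ltn_trans _ tp) // leq_subr.
Qed.

(** The multiples of [e] are p distinct roots of X^p - X. This computes the norm of an
    Artin-Schreier generator. *)
Lemma prod_sub_multiples (y : E) : \prod_(t < p) (y - e *+ t) = y ^+ p - y.
Proof.
have sz : size ('X^p - 'X : {poly E}) = p.+1.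
  by rewrite size_polyDl size_polyXn // size_polyN size_polyX.
have lc : lead_coef ('X^p - 'X : {poly E}) = 1.
  by rewrite lead_coefDl ?lead_coefXn // size_polyN size_polyXn size_polyX.
have := @all_roots_prod_XsubC _ ('X^p - 'X : {poly E}) rs.
have roots_rs : all (root ('X^p - 'X : {poly E})) rs.
  apply/allP => x /mapP [t _ ->].
  by rewrite rootE !hornerE multiple_exprp subrr.
rewrite size_map size_iota uniq_rootsE sz lc scale1r.
move=> /(_ erefl roots_rs uniq_rs) /(congr1 (horner^~ y)).
rewrite !hornerE => ->.
rewrite big_map -[X in iota _ X]subn0 big_mkord horner_prod.
by apply: eq_bigr => t _; rewrite !hornerE.
Qed.

                                                                         
                                                                        
(** At [y = 0] the sum is p - 1 ones, and a shift by [e] only permutes the terms, so the value -1 is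
    taken at all p multiples of [e]. As a polynomial in [y] the sum has degree less than p, hence is
    constant. *)
Lemma sum_translate_expr (y : E) : \sum_(t < p) (y + e *+ t) ^+ p.-1 = -1.
Proof.
pose S z := \sum_(t < p) (z + e *+ t) ^+ p.-1.
have S0 : S 0 = -1.
  rewrite /S -(big_mkord xpredT (fun t => (0 + e *+ t) ^+ p.-1)).
  rewrite big_ltn // mulr0n addr0 expr0n -subn1 subn_eq0 leqNgt p_gt1 add0r.
  rewrite (eq_big_nat _ _ (F2 := fun=> 1)) => [|t tp].
    by rewrite big_const_nat iter_addr_0 mulrnBr // (pcharf0 pE) sub0r.
  by rewrite add0r subn1 multiple_expr_pred.
have SD z : S (z + e) = S z.
  rewrite -[RHS](@sum_succ_mod _ p (fun t => (z + e *+ t) ^+ p.-1)).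
    by apply: eq_bigr => t _; rewrite mulrS addrA.
  by rewrite mulr0n -mulr_natr (pcharf0 pE) mulr0.
have Ss s : S (e *+ s) = -1.
  by elim: s => [|s IH]; rewrite ?mulr0n // mulrSr SD.
pose h : {poly E} := \sum_(t < p) ('X + (e *+ t)%:P) ^+ p.-1 + 1.
have hE z : h.[z] = S z + 1.
  rewrite !hornerE horner_sum; congr (_ + _).
  by apply: eq_bigr => t _; rewrite !hornerE.
have h0 : h = 0.
  apply/eqP/negPn/negP => hn0.
  have : (size rs < size h)%N.
    apply: max_poly_roots uniq_rs => //.
    by apply/allP => x /mapP [t _ ->]; rewrite rootE hE Ss addNr.
  rewrite size_map size_iota.
  rewrite ltnNge => /negP; apply; apply: (leq_trans (size_polyD _ _)).
  rewrite geq_max size_poly1 p_gt0 andbT; apply: (leq_trans (size_sum _ _ _)).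
  apply/bigmax_leqP => t _.
  by rewrite -[_%:P]opprK -polyCN size_exp_XsubC prednK.
by apply/eqP; rewrite -subr_eq0 opprK -hE h0 horner0.
Qed.

End PrimeSubfield.

(** * Fixed fields by Lagrange interpolation *)

Lemma map_poly_delta (R : nzRingType) (f : {rmorphism R -> R}) (x c : R)
    (n : nat) :
  map_poly f (x *: (1 - ('X - c%:P) ^+ n))
    = f x *: (1 - ('X - (f c)%:P) ^+ n).
Proof.
rewrite map_polyZ; congr (_ *: _).
by rewrite rmorphB rmorph1 rmorphXn rmorphB /= map_polyX map_polyC.
Qed.

                                                                             
                                                      
                                                                              
                                     
(** Interpolate: the polynomial sending each conjugate of [c] to the matching conjugate of [x] is
    permuted termwise by Frobenius, so its coefficients are fixed, and its value at [c] is [x].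
    Conjugates of [c] differ by multiples of [e], so 1 - (X - c_t)^(p-1) is the delta function at
    the conjugate c_t. *)
Lemma fixed_adjoin (p : nat) (E : fieldType) (pE : p \in [pchar E]) (n : nat)
    (c e x : E) :
  e ^+ p = e -> e != 0 -> c ^+ (p ^ n) = c + e -> x ^+ ((p ^ n) ^ p) = x ->
  adjoin [set y | y ^+ (p ^ n) = y]%classic c x.
Proof.
move=> ep e0 cq xq; have p_gt0 := prime_gt0 (pcharf_prime pE).
have eq : e ^+ (p ^ n) = e.
  by elim: (n) => [|m IH]; rewrite ?expr1 // expnS exprM ep.
have ct t := expr_translate pE t eq cq.
have [f fE] := frob_rmorphism pE n.
pose G t : {poly E} := x ^+ ((p ^ n) ^ t)
  *: (1 - ('X - (c ^+ ((p ^ n) ^ t))%:P) ^+ p.-1).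
have fG t : map_poly f (G t) = G t.+1.
  rewrite map_poly_delta.
  by rewrite !fE -!exprM -!expnSr.
have sumG : \sum_(t < p) G t.+1 = \sum_(t < p) G t.
  apply: sum_succ_mod.
  by rewrite /G ct -mulr_natr (pcharf0 pE) mulr0 addr0 xq !expr1.
exists (\sum_(t < p) G t) => /=.
  move=> k; rewrite -fE -coef_map /= -{2}sumG rmorph_sum /=.
  by under eq_bigr do rewrite fG.
(* At [c] only the term of index 0 survives; in the others the (p-1)-th power of a nonzero multiple
   of [e] is 1. *)
rewrite horner_sum -(prednK p_gt0) big_ord_recl big1 /= => [|t _].
  rewrite /G !hornerE expn0 !expr1 subrr expr0n -subn1 subn_eq0 leqNgt.
  by rewrite prime_gt1 ?(pcharf_prime pE) // subr0 mulr1.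
rewrite /G !hornerE ct /bump /= add1n opprD addrA subrr add0r -mulNrn.
rewrite (multiple_expr_pred pE); first by rewrite subrr mulr0.
- by have [g gE] := frob_rmorphism pE 1; rewrite -gE rmorphN gE ep.
- by rewrite oppr_eq0.
- by rewrite /= -ltn_predRL ltn_ord.
Qed.

(** * Splitting orders along coprime exponents *)

Lemma prim_root_coprime_mul (R : fieldType) (a b k l : nat) (x : R) :
  coprime a b -> k.-primitive_root (x ^+ a) -> l.-primitive_root (x ^+ b) ->
  (k %| b)%N -> (l %| a)%N -> (k * l)%N.-primitive_root x.
Proof.
move=> ab kx lx kb la.
have kl : coprime k l.
  by apply: coprime_dvdl kb _; apply: coprime_dvdr la _; rewrite coprime_sym.
have kl_gt0 : (0 < k * l)%N.
  by rewrite muln_gt0 (prim_order_gt0 kx) (prim_order_gt0 lx).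
have xm m : (x ^+ m == 1) = (k * l %| m)%N.
  rewrite Gauss_dvd // (prim_order_dvd kx) (prim_order_dvd lx) -!exprM.
  apply/idP/andP => [/eqP xm | [/eqP xa /eqP xb]].
    by rewrite ![(_ * m)%N]mulnC !exprM xm !expr1n.
  (* The Bezout relation is available for positive [a]; [a = 0] forces [b = 1]. *)
  have [a0 | a_gt0] := posnP a.
    by move: ab xb; rewrite a0 /coprime gcd0n => /eqP ->; rewrite mul1n => ->.
  have [u v uv _] := egcdnP b a_gt0.
  move: ab; rewrite /coprime => /eqP g1.
  have E1 : x ^+ (u * a * m) = 1 by rewrite -mulnA mulnC exprM xa expr1n.
  have E2 : x ^+ (v * b * m) = 1 by rewrite -mulnA mulnC exprM xb expr1n.
  by rewrite -E1 uv g1 mulnDl mul1n exprD E2 mul1r.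
have [n nx _] := prim_order_exists kl_gt0 (eqP (etrans (xm _) (dvdnn _))).
suff <- : n = (k * l)%N by [].
apply/eqP; rewrite eqn_dvd (prim_order_dvd nx) xm dvdnn /=.
by rewrite -xm (prim_expr_order nx).
Qed.

Lemma coprime_common_dvd (m n d : nat) :
  coprime m n -> (d %| m)%N -> (d %| n)%N -> d = 1%N.
Proof.
move=> mn dm dn; apply/eqP; rewrite -dvdn1 -(eqP (mn : gcdn m n == 1%N)).
by rewrite dvdn_gcd dm.
Qed.

Lemma sum_expn_mod_pred (n q : nat) : (0 < q)%N ->
  exists k, (\sum_(t < n) q ^ t = n + q.-1 * k)%N.
Proof.
move=> q_gt0; exists (\sum_(t < n) \sum_(s < t) q ^ s)%N.
rewrite big_distrr /= -[X in (X + _)%N]card_ord -sum1_card -big_split /=.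
apply: eq_bigr => t _.
by rewrite -predn_exp add1n prednK // expn_gt0 q_gt0.
Qed.

(** * Arithmetic of the numbers N_i *)

Section Nquot.

Context (p : nat) (p_prime : prime p).

Let p_gt0 := prime_gt0 p_prime.
Let p_gt1 := prime_gt1 p_prime.

Lemma Nquot_sum i : Nquot p i = (\sum_(t < p) (p ^ (p ^ i)) ^ t)%N.
Proof.
rewrite /Nquot expnSr expnM predn_exp mulKn // -subn1 subn_gt0.
by rewrite -{1}(expn0 p) ltn_exp2l // expn_gt0 p_gt0.
Qed.

Lemma Nquot_mul_pred i :
  (Nquot p i * (p ^ (p ^ i)).-1)%N = (p ^ (p ^ i.+1)).-1.
Proof. by rewrite Nquot_sum mulnC -predn_exp -expnM -expnSr. Qed.

(** N_i is a sum of p powers of q_i, hence congruent to p modulo q_i - 1, and q_i - 1 is prime to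
    p. *)
Lemma coprime_Nquot_pred i : coprime (Nquot p i) (p ^ (p ^ i)).-1.
Proof.
have q_gt0 : (0 < p ^ (p ^ i))%N by rewrite expn_gt0 p_gt0.
have [k kE] := sum_expn_mod_pred p q_gt0.
rewrite Nquot_sum kE coprime_sym /coprime addnC mulnC gcdnMDl -/(coprime _ _).
apply: (@coprime_dvdr _ (p ^ (p ^ i))).
  by rewrite dvdn_exp // expn_gt0 p_gt0.
by rewrite -[X in coprime _ X](prednK q_gt0) coprimenS.
Qed.

Lemma coprime_Nquot_prime_pred i : coprime (Nquot p i) p.-1.
Proof.
apply: coprime_dvdr (coprime_Nquot_pred i).
by rewrite -(prednK p_gt0) predn_exp dvdn_mulr.
Qed.

(** Modulo r, q_i has order exactly p: its p-th power q_(i+1) is 1, and q_i is not 1 by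
    [coprime_Nquot_pred]. Fermat concludes. *)
Lemma prime_dvd_Nquot r i : prime r -> (r %| Nquot p i)%N -> (p %| r.-1)%N.
Proof.
move=> r_prime rN; have r_gt1 := prime_gt1 r_prime.
pose x : 'F_r := (p ^ (p ^ i))%:R.
have q_gt0 : (0 < p ^ (p ^ i))%N by rewrite expn_gt0 p_gt0.
have x1 : x != 1.
  apply/negP => /eqP x1; have : (r %| (p ^ (p ^ i)).-1)%N.
    rewrite (dvdn_pcharf (pchar_Fp r_prime)) -subn1 natrB // -/x x1.
    by rewrite subrr.
  move=> rq; move: (coprime_Nquot_pred i).
  by move/coprime_common_dvd => /(_ _ rN rq) r1; rewrite r1 in r_gt1.
have xp : x ^+ p = 1.
  apply/eqP; rewrite -subr_eq0 -natrX -[X in _ - X]/(1%:R).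
  rewrite -natrB ?expn_gt0 ?p_gt0 //.
  rewrite -(dvdn_pcharf (pchar_Fp r_prime)) subn1 -expnM -expnSr.
  by rewrite -Nquot_mul_pred dvdn_mulr.
have x0 : x != 0.
  apply: contra_eq_neq xp => ->.
  by rewrite expr0n gtn_eqF // eq_sym oner_eq0.
have [n nx np] := prim_order_exists p_gt0 xp.
have n1 : n != 1%N.
  by apply: contraNneq x1 => n1; rewrite -(prim_expr_order nx) n1 expr1.
rewrite -(prime_nt_dvdP p_prime n1 np) (prim_order_dvd nx).
apply/eqP/(mulfI x0); rewrite mulr1 -exprS prednK ?prime_gt0 //.
by have := expf_card x; rewrite card_Fp.
Qed.

                                                                            
                                                                              
                    
(** A common prime r is 1 modulo p and at most 2p - 1, so r = p + 1, forcing p = 2 and r = 3. For i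
    > 0, 3 divides q_i - 1, which is prime to N_i. *)
Lemma coprime_Nquot_double_pred i :
  odd p || (0 < i)%N -> coprime (Nquot p i) (p.-1 + p).
Proof.
move=> H; rewrite /coprime; apply: contraT => g1.
have [|r r_prime] := pdivP (n := gcdn (Nquot p i) (p.-1 + p)).
  by rewrite ltn_neqAle eq_sym g1 gcdn_gt0 addn_gt0 p_gt0 !orbT.
rewrite dvdn_gcd => /andP [rN rp]; have r_gt1 := prime_gt1 r_prime.
have /dvdnP [k rk] := prime_dvd_Nquot r_prime rN.
have r_le : (r <= p.-1 + p)%N.
  by apply: dvdn_leq; rewrite // addn_gt0 p_gt0 orbT.
have k1 : k = 1%N.
  case: k rk => [|[|k]] // rk; first by lia.
  by move: p_gt1 => ?; nia.
have {k1 rk} rE : r = p.+1 by rewrite -(prednK (ltnW r_gt1)) rk k1 mul1n.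
have [p2|p_odd] := even_prime p_prime; last first.
  case: (even_prime r_prime) => [r2|]; last by rewrite rE /= p_odd.
  by move: p_gt1; rewrite -ltnS -rE r2.
case: i {g1} rN H => [|i] rN; first by rewrite p2.
have rq : (r %| (p ^ (p ^ i.+1)).-1)%N.
  by rewrite expnS expnM predn_exp rE p2 dvdn_mulr.
by have := coprime_common_dvd (coprime_Nquot_pred i.+1) rN rq; rewrite rE p2.
Qed.

End Nquot.

(** * Frobenius action, norms and orders in the tower *)

Section Tower.

Context (p : nat) (p_prime : prime p) (E : closedFieldType)
  (iota : {rmorphism 'F_p -> E}) (c : nat -> E) (c_tower : as_tower_seq p c).

Let p_gt0 := prime_gt0 p_prime.
Let p_gt1 := prime_gt1 p_prime.
Let pE : p \in [pchar E] := rmorph_pchar iota (pchar_Fp p_prime).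
Let q i := (p ^ (p ^ i))%N.
Let P i := \prod_(j < i) c j.

Let q_gt0 i : (0 < q i)%N. Proof. by rewrite expn_gt0 p_gt0. Qed.
Let qS i : q i.+1 = (q i ^ p)%N. Proof. by rewrite /q expnSr expnM. Qed.

Lemma sign_expr_prime n i : ((-1) ^+ i : E) ^+ (p ^ n) = (-1) ^+ i.
Proof. by have [f fE] := frob_rmorphism pE n; rewrite -fE rmorph_sign. Qed.

Lemma sign_neq0 i : (-1) ^+ i != 0 :> E.
Proof. by rewrite expf_neq0 // oppr_eq0 oner_neq0. Qed.

Lemma tower_expr_prime i : c i ^+ p = c i + P i ^+ p.-1.
Proof.
have := c_tower i; rewrite rootE !hornerE subr_eq0 => /eqP <-.
by rewrite addrC subrK.
Qed.

Lemma expr_fixed (x : E) m n : x ^+ m = x -> x ^+ (m ^ n) = x.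
Proof. by move=> xm; elim: n => [|n IH]; rewrite ?expr1 // expnSr exprM IH. Qed.

                                                                       
                                                                
(** Both halves are proved together: the trace tells how Frobenius moves c_i, which gives the next
    fixedness and the next trace. *)
Lemma tower_trace_fixed i :
  \sum_(j < p ^ i) (P i ^+ p.-1) ^+ (p ^ j) = (-1) ^+ i /\ P i ^+ q i = P i.
Proof.
elim: i => [|i [tr Pq]].
  by rewrite big_ord_recl big_ord0 /P big_ord0 !expr1n addr0.
have cq : c i ^+ q i = c i + (-1) ^+ i.
  by rewrite (iter_frob_AS pE _ (tower_expr_prime i)) tr.
have ct t : c i ^+ (q i ^ t) = c i + ((-1) ^+ i) *+ t.
  exact: (expr_translate pE t (sign_expr_prime _ i) cq).
have PS : P i.+1 = P i * c i by rewrite /P big_ord_recr.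
split; last first.
  rewrite PS qS exprMn expr_fixed // ct.
  by rewrite -[_ *+ p]mulr_natr (pcharf0 pE) mulr0 addr0.
rewrite expnSr (sum_iter_frob pE) PS.
(* The relative trace: P_i is fixed and factors out, leaving the sum of (p-1)-th powers over the
   translates of c_i. *)
have trS : \sum_(s < p) ((P i * c i) ^+ p.-1) ^+ (q i ^ s) = - P i ^+ p.-1.
  rewrite -mulrN1 -(sum_translate_expr pE _ (sign_neq0 i) (c i)); last first.
    exact: (sign_expr_prime 1).
  rewrite big_distrr /=; apply: eq_bigr => s _.
  by rewrite exprAC exprMn expr_fixed // ct -exprMn.
rewrite trS exprS mulN1r -tr -sumrN; apply: eq_bigr => j _.
by have [f fE] := frob_rmorphism pE j; rewrite -!fE rmorphN.
Qed.

Lemma tower_conj i : c i ^+ q i = c i + (-1) ^+ i.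
Proof.
have [tr _] := tower_trace_fixed i.
by rewrite (iter_frob_AS pE _ (tower_expr_prime i)) tr.
Qed.

Lemma tower_neq0 i : c i != 0.
Proof.
apply/negP => /eqP ci0; have := tower_conj i.
rewrite ci0 expr0n gtn_eqF // add0r => /eqP.
by rewrite eq_sym (negPf (sign_neq0 i)).
Qed.

Lemma tower_prod_neq0 i : P i != 0.
Proof. by apply/prodf_neq0 => j _; exact: tower_neq0. Qed.

Lemma tower_prod_fixed i : P i ^+ q i = P i.
Proof. by case: (tower_trace_fixed i). Qed.

Lemma tower_prod_order i : P i ^+ (q i).-1 = 1.
Proof.
apply: (mulfI (tower_prod_neq0 i)).
by rewrite -exprS prednK // tower_prod_fixed mulr1.
Qed.

Lemma tower_fixed i : c i ^+ q i.+1 = c i.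
Proof.
rewrite qS (expr_translate pE p (sign_expr_prime _ i) (tower_conj i)).
by rewrite -mulr_natr (pcharf0 pE) mulr0 addr0.
Qed.

Lemma tower_norm i : c i ^+ Nquot p i = P i ^+ p.-1.
Proof.
rewrite Nquot_sum // expr_sum.
have eN : (- (-1) ^+ i : E) ^+ p = - (-1) ^+ i.
  by rewrite -mulN1r -exprS -{1}(expn1 p) sign_expr_prime.
transitivity (c i ^+ p - c i); last by rewrite tower_expr_prime addrC addKr.
rewrite -(prod_sub_multiples pE eN); last by rewrite oppr_eq0 sign_neq0.
apply: eq_bigr => t _; rewrite mulNrn opprK.
exact: (expr_translate pE t (sign_expr_prime _ i) (tower_conj i)).
Qed.

(** Identifies L_(i-1) with the field of q_i elements, so that membership becomes an equation
    between powers; the converse inclusion in the inductive step is [fixed_adjoin]. *)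
Lemma pred_fieldP i x : pred_field iota c i x <-> x ^+ q i = x.
Proof.
elim: i x => [|i IH] x; split.
- case=> y _ <-; rewrite /q expn0 expn1 -rmorphXn; congr (iota _).
  by have := expf_card y; rewrite card_Fp.
- rewrite /q expn0 expn1 => xp; have : root ('X^#|'F_p| - 'X : {poly E}) x.
    by rewrite rootE !hornerE card_Fp // xp subrr.
  (* X^p - X already splits over the prime field, so all its roots in [E] come from [iota]. *)
  have -> : 'X^#|'F_p| - 'X = map_poly iota ('X^#|'F_p| - 'X).
    by rewrite rmorphB rmorphXn /= map_polyX.
  rewrite finField_genPoly rmorph_prod rootE horner_prod.
  move=> /eqP/eqP/prodf_eq0 [y _].
  rewrite rmorphB /= map_polyX map_polyC /= !hornerE subr_eq0 => /eqP ->.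
  by exists y.
- case=> g gK <-; have [f fE] := frob_rmorphism pE (p ^ i.+1).
  rewrite -fE -horner_map /= fE tower_fixed; congr (_.[_]).
  apply/polyP => k; rewrite coef_map /= fE.
  by rewrite -/(q i.+1) qS expr_fixed //; apply/IH/gK.
- rewrite qS => xq.
  have [g gK gx] :=
    fixed_adjoin pE (sign_expr_prime 1 i) (sign_neq0 i) (tower_conj i) xq.
  by exists g => // k; apply/IH/gK.
Qed.

(** c_i^m is fixed by the q_i-Frobenius exactly when (c_i^(q_i - 1))^m = 1. *)
Lemma Mord_primitive i :
  (Mord iota c i).-primitive_root (c i ^+ (q i).-1).
Proof.
have Kc m : pred_field iota c i (c i ^+ m) <-> (c i ^+ (q i).-1) ^+ m = 1.
  rewrite pred_fieldP -exprM mulnC exprM; split=> [cm|cm].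
    apply: (mulfI (expf_neq0 m (tower_neq0 i))).
    by rewrite -exprS prednK // mulr1.
  by rewrite -(prednK (q_gt0 i)) exprS cm mulr1.
have N_gt0 : (0 < Nquot p i)%N.
  rewrite Nquot_sum // (bigD1 (Ordinal p_gt0)) //.
have [|n nx _] := @prim_order_exists _ (Nquot p i) (c i ^+ (q i).-1) N_gt0.
  apply/Kc/pred_fieldP; rewrite tower_norm.
  by rewrite exprAC tower_prod_fixed.
suff -> : Mord iota c i = n by [].
have n_min m : (0 < m)%N -> pred_field iota c i (c i ^+ m) -> (n <= m)%N.
  by move=> m_gt0 /Kc/eqP; rewrite -(prim_order_dvd nx); apply: dvdn_leq.
(* The order exists and is unique, so the default 0 of [order_mod] is not taken. *)
apply: xget_unique => [|m [[m_gt0 Km _] m_min]].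
  split; last by move=> m [m_gt0 Km _]; apply: n_min.
  split; first exact: prim_order_gt0 nx.
    by apply/Kc/prim_expr_order.
  exact/expf_neq0/tower_neq0.
apply/eqP; rewrite eqn_leq n_min // andbT; apply: m_min.
split; first exact: prim_order_gt0 nx.
  by apply/Kc/prim_expr_order.
exact/expf_neq0/tower_neq0.
Qed.

Lemma Mord_dvd_Nquot i : (Mord iota c i %| Nquot p i)%N.
Proof.
rewrite (prim_order_dvd (Mord_primitive i)) -exprM mulnC Nquot_mul_pred //.
rewrite -/(q i.+1); apply/eqP/(mulfI (tower_neq0 i)).
by rewrite -exprS prednK // tower_fixed mulr1.
Qed.

(** Frobenius translates c_i by a sign, so c_i lies outside L_(i-1). *)
Lemma Mord_neq1 i : Mord iota c i != 1%N.
Proof.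
apply/negP => /eqP M1; have := prim_expr_order (Mord_primitive i).
rewrite M1 expr1 => c1; have := tower_conj i.
rewrite -(prednK (q_gt0 i)) exprS c1 mulr1 => /eqP.
by rewrite -subr_eq0 opprD addrA subrr sub0r oppr_eq0 (negPf (sign_neq0 i)).
Qed.

Lemma Mord_prime i : prime (Nquot p i) -> Mord iota c i = Nquot p i.
Proof.
by move=> N_pr; apply/(prime_nt_dvdP N_pr (Mord_neq1 i))/Mord_dvd_Nquot.
Qed.

Lemma tower_order k i :
  k.-primitive_root (P i ^+ p.-1) ->
  (k * Mord iota c i)%N.-primitive_root (c i).
Proof.
move=> kP; apply: (prim_root_coprime_mul (coprime_Nquot_pred p_prime i)).
- by rewrite tower_norm.
- exact: Mord_primitive.
- by rewrite (prim_order_dvd kP) exprAC tower_prod_order expr1n.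
- exact: Mord_dvd_Nquot.
Qed.

Lemma tower_prod_order_step k i :
  k.-primitive_root (P i ^+ (p.-1 + p)) ->
  (k * Mord iota c i)%N.-primitive_root (P i.+1).
Proof.
have PS : P i.+1 = P i * c i by rewrite /P big_ord_recr.
move=> kP; apply: (prim_root_coprime_mul (coprime_Nquot_pred p_prime i)).
(* N_i is p modulo q_i - 1, an exponent that kills P_i; with the norm P_i^(p-1) of c_i the total
   exponent is 2p - 1. *)
- rewrite PS exprMn tower_norm mulrC; suff -> : P i ^+ Nquot p i = P i ^+ p.
    by rewrite -exprD.
  have [m] := sum_expn_mod_pred p (q_gt0 i); rewrite -Nquot_sum // => ->.
  by rewrite exprD exprM tower_prod_order expr1n mulr1.
- rewrite PS exprMn tower_prod_order mul1r; exact: Mord_primitive.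
- by rewrite (prim_order_dvd kP) exprAC tower_prod_order expr1n.
- exact: Mord_dvd_Nquot.
Qed.

End Tower.

(** * Fermat primes and the final count of orders *)

(** These are the Fermat numbers 2^(2^i) + 1: 3, 5, 17, 257, 65537. *)
Lemma prime_Nquot2 i : (i < 5)%N -> prime (Nquot 2 i).
Proof.
rewrite Nquot_sum // !big_ord_recl big_ord0 expn0 expn1 addn0.
by case: i => [|[|[|[|[|//]]]]] _; vm_compute.
Qed.

Lemma Mord_Nquot2 (p : nat) (p_prime : prime p)
    (E : closedFieldType) (iota : {rmorphism 'F_p -> E})
    (c : nat -> E) (c_tower : as_tower_seq p c) (i : nat) :
  p = 2%N -> (i < 5)%N -> Mord iota c i = Nquot p i.
Proof.
by move=> p2 i5; apply: Mord_prime => //; rewrite p2; apply: prime_Nquot2.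
Qed.

Theorem corollary4p7 (p : nat) (p_prime : prime p)
    (E : closedFieldType) (iota : {rmorphism 'F_p -> E})
    (E_closure : algebraic_closure iota)
    (c : nat -> E) (c_tower : as_tower_seq p c) :
  let M := Mord iota c in
  let N := Nquot p in
  (odd p ->
     forall i : nat, (\prod_(0 <= j < i.+1) M j)%N.-primitive_root (c i)) /\
  (p = 2%N ->
     [/\ (N 0%N).-primitive_root (c 0%N),
         (N 0 * N 1)%N.-primitive_root (c 1%N),
         (N 1 * N 2)%N.-primitive_root (c 2%N),
         (N 1 * N 2 * N 3)%N.-primitive_root (c 3%N) &
         (N 1 * N 2 * N 3 * N 4)%N.-primitive_root (c 4%N)] /\
     (forall i : nat, (5 <= i)%N ->
        (N 1 * N 2 * N 3 * N 4 * \prod_(5 <= j < i.+1) M j)%N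
          .-primitive_root (c i))).
Proof.
move=> M N.
have co_prod (s n k : nat) :
    (forall j, (s <= j)%N -> coprime (N j) k) ->
    coprime k (\prod_(s <= j < n) M j)%N.
  move=> Nk; rewrite big_nat_cond; apply: (big_ind (coprime k)).
  - exact: coprimen1.
  - by move=> x y xk yk; rewrite coprimeMr xk.
  move=> j; rewrite andbT => /andP [sj _]; rewrite coprime_sym.
  exact: coprime_dvdl (Mord_dvd_Nquot p_prime iota c_tower j) (Nk j sj).
(* Used with [k] equal to p - 1 or 2p - 1: such powers keep the order. The start [s] is 0 for odd p
   and 1 for p = 2. *)
have step s k : (forall j, (s <= j)%N -> coprime (N j) k) ->
    forall i x, (\prod_(s <= j < i) M j)%N.-primitive_root x ->
    (\prod_(s <= j < i) M j)%N.-primitive_root (x ^+ k).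
  by move=> Nk i x ix; rewrite (prim_root_exp_coprime _ ix) co_prod.
have N_pred j : coprime (N j) p.-1 by exact: coprime_Nquot_prime_pred.
have prim1 x : x = 1 -> 1.-primitive_root (x : E).
  by move=> x1; have [m mx] := prim_order_exists (ltn0Sn 0) (x1 : x ^+ 1 = 1);
    rewrite dvdn1 => /eqP m1; rewrite m1 in mx.
split=> [p_odd i | p2].
  have P_order n :
      (\prod_(0 <= j < n) M j)%N.-primitive_root (\prod_(j < n) c j).
    elim: n => [|n IH]; first by rewrite big_geq // big_ord0; exact: prim1.
    rewrite big_nat_recr //=; apply: tower_prod_order_step => //.
    apply: step IH => j _; apply: coprime_Nquot_double_pred => //.
    by rewrite p_odd.
  rewrite big_nat_recr //=; apply: tower_order => //.
  exact: step (P_order i).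
have M0 : M 0%N = 3%N by rewrite /M (Mord_Nquot2 p_prime iota c_tower p2) // p2.
have c0_order : (M 0%N).-primitive_root (c 0%N).
  rewrite -[M 0%N]mul1n; apply: tower_order => //.
  by apply: prim1; rewrite big_ord0 expr1n.
(* The product starts at 1: P_1 = c_0 has order 3 = 2p - 1, so P_1^(2p-1) = 1 and M_0 drops out of
   O(P_2). *)
have P_order n :
    (\prod_(1 <= j < n.+2) M j)%N.-primitive_root (\prod_(j < n.+2) c j).
  elim: n => [|n IH].
    rewrite big_nat1 -[M 1%N]mul1n; apply: tower_prod_order_step => //.
    apply: prim1; rewrite big_ord_recl big_ord0 mulr1 p2.
    by rewrite -(prim_expr_order c0_order) M0.
  rewrite big_nat_recr //=; apply: tower_prod_order_step => //.
  apply: step IH => j j_gt0; apply: coprime_Nquot_double_pred => //.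
  by rewrite j_gt0 orbT.
have c_order n :
    (\prod_(1 <= j < n.+3) M j)%N.-primitive_root (c n.+2).
  rewrite big_nat_recr //=; apply: tower_order => //.
  exact: step (P_order n).
have MN i : (i < 5)%N -> M i = N i by move=> i5; exact: Mord_Nquot2.
have prodS n :
    (\prod_(1 <= j < n.+2) M j = \prod_(1 <= j < n.+1) M j * M n.+1)%N.
  by rewrite big_nat_recr.
have prod3 : (\prod_(1 <= j < 3) M j = M 1 * M 2)%N by rewrite prodS big_nat1.
split; first split.
- by rewrite -MN.
(* Here P_1^(p-1) is c_0 itself, so the factor N_0 still survives in O(c_1). *)
- rewrite -!MN //; apply: tower_order => //.
  by rewrite big_ord_recl big_ord0 mulr1 p2 expr1.
- by rewrite -!MN // -prod3; exact: c_order 0%N.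
- by rewrite -!MN // -prod3 -prodS; exact: c_order 1%N.
- by rewrite -!MN // -prod3 -!prodS; exact: c_order 2%N.
case=> [|[|i]] // i5; have i5' : (5 <= i.+3)%N by exact: leqW.
by rewrite -!MN // -prod3 -!prodS -big_cat_nat //; exact: c_order i.
Qed.
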